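(* Let $k>4$ be a fixed integer. The probability (with respect to the Gaussian measure $W$ on $\mathcal{P}^k(\mathbb{R}^n)$) that a $k$-homogeneous polynomial $P:\mathbb{R}^n\to\mathbb{R}$ attains a relative maximum at some vertex of the zero-centered $n$-dimensional simplex $\Delta$ tends to one as $n\to\infty$. That is, if $a_1,\ldots,a_{n+1}$ are the vertices of $\Delta$ and $A_i\subset\mathcal{P}^k(\mathbb{R}^n)$ is the set of polynomials attaining a relative maximum at $a_i$, then $$\lim_{n\to\infty} W\Bigl(\bigcup_{i=1}^{n+1}A_i\Bigr)=1.$$
   Context: Polynomials and measure: $\mathcal{P}^k(\mathbb{R}^n)$ is the space of real $k$-homogeneous polynomials in $n$ variables, of dimension $d=\binom{n+k-1}{k}$, with the Hilbert space structure given by the Bombieri norm: for $P(x)=\sum_{|\alpha|=k}a_\alpha x^\alpha$, $$\|P\|=\Bigl(\sum_{|\alpha|=k}a_\alpha^2\,\frac{\alpha!}{k!}\Bigr)^{1/2}.$$ $W$ is the standard Gaussian measure of this Hilbert space: $W(B)=(2\pi)^{-d/2}\int_B e^{-\|P\|^2/2}\,dP$ for Borel sets $B\subset\mathcal{P}^k(\mathbb{R}^n)$, where $dP$ is Lebesgue measure normalized by this Hilbert space structure. $W$ is invariant under $P\mapsto P\circ T$ for orthogonal $T:\mathbb{R}^n\to\mathbb{R}^n$. Simplex: let $\Delta^+=\{x\in\mathbb{R}^{n+1}: x_i\geq 0 \text{ for } i=1,\ldots,n+1,\ \sum_{i=1}^{n+1}x_i=1\}$, the convex hull of the canonical basis of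 $\mathbb{R}^{n+1}$, and let $z=(\frac1{n+1},\ldots,\frac1{n+1})$. The zero-centered $n$-dimensional simplex is $\Delta=\Delta^+-z$, contained in the $n$-dimensional subspace $S=\{x\in\mathbb{R}^{n+1}:\sum_{i=1}^{n+1} x_i=0\}$, which is identified with $\mathbb{R}^n$ by a linear isometry (the choice of isometry is irrelevant). Relative maximum at a vertex: let $a$ be a vertex of $\Delta$, let $b_1,\ldots,b_n$ be the other $n$ vertices, and put $v_i=\frac{a-b_i}{\|a-b_i\|}$ for $i=1,\ldots,n$. A polynomial $P$ is said to attain a relative maximum (relative to $\Delta$) at the vertex $a$ if its gradient at $a$ is outward pointing, i.e. if $\frac{\partial P}{\partial v_i}(a)=\langle\nabla P(a),v_i\rangle>0$ for all $i=1,\ldots,n$. *)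

(* Defs.v *)
From HB Require Import structures.
(* The notations of mpoly clash with those of MathComp-Analysis. *)
From mathcomp.multinomials Require Import -(notations) mpoly.
From mathcomp Require Import all_boot all_order all_algebra.
From mathcomp Require Import all_classical all_reals all_analysis.
From mathcomp Require Import measurable_realfun ring lra.

Set Implicit Arguments.
Unset Strict Implicit.
Unset Printing Implicit Defensive.

Import Order.TTheory GRing.Theory Num.Theory.
Import numFieldNormedType.Exports.

Local Open Scope classical_set_scope.
Local Open Scope ring_scope.

Section LebesgueTuple.
Variable R : realType.
Local Notation RM := (measurableTypeR R).

Definition tuple_cons n (x : RM * n.-tuple RM) : n.+1.-tuple RM :=
  [the n.+1.-tuple RM of x.1 :: x.2].

Lemma measurable_tuple_cons n :
  measurable_fun [set: RM * n.-tuple RM] (@tuple_cons n).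
Proof. exact: measurable_cons. Qed.

Section step.
Variables (n : nat) (mu : {sigma_finite_measure set (n.-tuple RM) -> \bar R}).

Definition lebesgue_cons : set (n.+1.-tuple RM) -> \bar R :=
  pushforward (lebesgue_measure \x mu)%E (@tuple_cons n).

Let prodm : {measure set (RM * n.-tuple RM)%type -> \bar R} :=
  (lebesgue_measure \x mu)%E.

Let mc A : measurable A -> measurable (@tuple_cons n @^-1` A).
Proof.
by move=> mA; rewrite -[X in measurable X]setTI; exact: measurable_tuple_cons.
Qed.

Let lebesgue_cons0 : lebesgue_cons set0 = 0%E.
Proof. by rewrite /lebesgue_cons /pushforward preimage_set0 measure0. Qed.

Let lebesgue_cons_ge0 A : (0 <= lebesgue_cons A)%E.
Proof. exact: (measure_ge0 prodm). Qed.

Let lebesgue_cons_sigma_additive : semi_sigma_additive lebesgue_cons.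
Proof.
move=> F mF tF mUF; rewrite /lebesgue_cons /pushforward preimage_bigcup.
apply: (@measure_semi_sigma_additive _ _ _ prodm).
- by move=> i; exact: mc.
- apply/trivIsetP => /= i j _ _ ij; rewrite -preimage_setI.
  by move/trivIsetP : tF => /(_ _ _ _ _ ij) ->//; rewrite preimage_set0.
- by rewrite -preimage_bigcup; exact: mc.
Qed.

HB.instance Definition _ := isMeasure.Build _ _ _ lebesgue_cons
  lebesgue_cons0 lebesgue_cons_ge0 lebesgue_cons_sigma_additive.

Let lebesgue_cons_sigma_finite : sigma_finite setT lebesgue_cons.
Proof.
have /sigma_finiteP[F [FT ndF Foo]] := sigma_finiteT (@lebesgue_measure R).
have /sigma_finiteP[G [GT ndG Goo]] := sigma_finiteT mu.
pose u (t : n.+1.-tuple RM) : RM * n.-tuple RM := (thead t, [tuple of behead t]).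
have mu_ : measurable_fun [set: n.+1.-tuple RM] u.
  apply/measurable_fun_pair; last exact: measurable_behead.
  exact: measurable_tnth.
have uK x : u (tuple_cons x) = x.
  by case: x => x t; congr pair => //; exact: val_inj.
exists (fun i => u @^-1` (F i `*` G i)).
  apply/esym/seteqP; split => // t _.
  have [i _ Fi] : (\bigcup_i F i) (u t).1 by rewrite -FT.
  have [j _ Gj] : (\bigcup_i G i) (u t).2 by rewrite -GT.
  exists (maxn i j) => //; split.
  - by move: (u t).1 Fi; exact/subsetPset/ndF/leq_maxl.
  - by move: (u t).2 Gj; exact/subsetPset/ndG/leq_maxr.
move=> i; have [mFi Fioo] := Foo i; have [mGi Gioo] := Goo i; split.
  by rewrite -[X in measurable X]setTI; apply: mu_ => //; exact: measurableX.
rewrite /lebesgue_cons /pushforward -comp_preimage.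
rewrite (_ : u \o _ = id); last by apply/funext => x; exact: uK.
by rewrite product_measure1E// lte_mul_pinfty// ge0_fin_numE.
Qed.

HB.instance Definition _ := Measure_isSigmaFinite.Build _ _ _ lebesgue_cons
  lebesgue_cons_sigma_finite.
End step.

(* The Lebesgue measure of R^n: the iterated product of the one of R. *)
Fixpoint lebesgue_tuple n : {sigma_finite_measure set (n.-tuple RM) -> \bar R} :=
  match n with
  | 0 => \d_([tuple] : 0.-tuple RM)
  | n.+1 => lebesgue_cons (lebesgue_tuple n)
  end.

End LebesgueTuple.

Section HomogeneousPolynomials.
Variables (R : realType) (n k : nat).
Local Notation RM := (measurableTypeR R).

Definition hpoly := dhomog n R k.
HB.instance Definition _ := GRing.Lmodule.on hpoly.
HB.instance Definition _ := isPointed.Build hpoly 0.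

Definition mindex := {m : bmultinom n k.+1 | mdeg m == k}.
HB.instance Definition _ := Finite.on mindex.
Coercion multinom_of_mindex (m : mindex) : multinom n := val m.

Definition hcoeff (m : mindex) (P : hpoly) : R := mcoeff m P.

(* The Borel sets: P^k(R^n) has finite dimension, so they are generated by the
   coefficient functionals. *)
Definition hpoly_borel : set (set hpoly) :=
  <<s \bigcup_(m : mindex) preimage_set_system [set: hpoly]
        (hcoeff m : hpoly -> RM) measurable >>.

Let hpoly_borel0 : hpoly_borel set0.
Proof. exact: sigma_algebra0. Qed.

Let hpoly_borelC A : hpoly_borel A -> hpoly_borel (~` A).
Proof. exact: sigma_algebraC. Qed.

Let hpoly_borel_bigcup (F : (set hpoly)^nat) :
  (forall i, hpoly_borel (F i)) -> hpoly_borel (\bigcup_i F i).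
Proof. exact: sigma_algebra_bigcup. Qed.

HB.instance Definition _ := @isMeasurable.Build default_measure_display hpoly
  hpoly_borel hpoly_borel0 hpoly_borelC hpoly_borel_bigcup.

Definition mfact (m : multinom n) : nat := (\prod_(i < n) (m i)`!)%N.

Definition bombieri_norm (P : hpoly) : R :=
  Num.sqrt (\sum_(m : mindex) hcoeff m P ^+ 2 * ((mfact m)%:R / k`!%:R)).

Lemma mindex_homog (m : mindex) : mpolyX R m \is ishomog1 k mdeg.
Proof. by rewrite dhomogX; exact: (valP m). Qed.

(* The Bombieri inner product makes the monomials orthogonal, with
   ||X^m||^2 = m! / k!; this is X^m normalized. *)
Definition bombieri_basis (m : mindex) : hpoly :=
  Num.sqrt (k`!%:R / (mfact m)%:R) *: (DHomog (mindex_homog m) : hpoly).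

Definition hpoly_dim : nat := #|{: mindex}|.

Definition hpoly_of_coords (c : hpoly_dim.-tuple RM) : hpoly :=
  \sum_(m : mindex) (tnth c (enum_rank m) : R) *: bombieri_basis m.

(* [hpoly_of_coords] is an isometry from the Euclidean R^d, see
   [bombieri_norm_of_coords]. *)
Definition hpoly_lebesgue : set hpoly -> \bar R :=
  pushforward (lebesgue_tuple R hpoly_dim) hpoly_of_coords.

(* W(B) = (2 pi)^(-d/2) \int_B exp(- ||P||^2 / 2) dP *)
Definition gaussW (B : set hpoly) : \bar R :=
  (((2 * pi) `^ (- (hpoly_dim%:R / 2)))%:E *
   \int[hpoly_lebesgue]_(P in B) (expR (- (bombieri_norm P ^+ 2 / 2)))%:E)%E.

End HomogeneousPolynomials.

Section HpolyFacts.
Variables (R : realType) (n k : nat).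
Local Notation RM := (measurableTypeR R).
Local Notation dim := (hpoly_dim n k).
Implicit Types (m : mindex n k) (c : dim.-tuple RM) (P : hpoly R n k).

Lemma mfact_gt0 (m : multinom n) : (0 < mfact m)%N.
Proof. by apply: prodn_gt0 => i; exact: fact_gt0. Qed.

Lemma hcoeff_of_coords m c : hcoeff m (hpoly_of_coords c) =
  (tnth c (enum_rank m) : R) * Num.sqrt (k`!%:R / (mfact m)%:R).
Proof.
rewrite /hcoeff /hpoly_of_coords.
rewrite (raddf_sum (@mpoly_of_dhomog n R k)) raddf_sum /= (bigD1 m) //=.
rewrite big1 ?addr0 => [|m' m'm].
  by rewrite /bombieri_basis !mcoeffZ/= mcoeffX eqxx mulr1.
rewrite /bombieri_basis !mcoeffZ/= mcoeffX.
have -> : (multinom_of_mindex m' == multinom_of_mindex m) = false.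
  by apply/negbTE; apply: contra m'm => /eqP e; apply/eqP/val_inj/val_inj.
by rewrite !mulr0.
Qed.

Lemma bombieri_norm_of_coords c :
  bombieri_norm (hpoly_of_coords c) = Num.sqrt (\sum_i (tnth c i : R) ^+ 2).
Proof.
rewrite /bombieri_norm; congr Num.sqrt.
rewrite [RHS](reindex (@enum_rank (mindex n k))) /=; last first.
  exact/onW_bij/enum_rank_bij.
apply: eq_bigr => m _; rewrite hcoeff_of_coords exprMn sqr_sqrtr ?divr_ge0//.
rewrite -mulrA mulf_div mulrC (mulrC k`!%:R) divff ?mul1r//.
by rewrite mulf_neq0// pnatr_eq0 -lt0n ?fact_gt0 ?mfact_gt0.
Qed.

Lemma measurable_hcoeff m :
  measurable_fun [set: hpoly R n k] (hcoeff m : hpoly R n k -> RM).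
Proof.
move=> _ A mA; apply: sub_sigma_algebra; exists m => //; exists A => //.
Qed.

Lemma measurable_hpoly_of_coords :
  measurable_fun [set: dim.-tuple RM] (@hpoly_of_coords R n k).
Proof.
apply: (@measurability _ _ _ _ _ _ (\bigcup_(m : mindex n k)
  preimage_set_system [set: hpoly R n k] (hcoeff m : hpoly R n k -> RM)
    measurable)) => //.
move=> _ [_ [m _ [A mA <-] <-]].
rewrite !setTI -comp_preimage -[X in measurable X]setTI.
pose f c := (tnth c (enum_rank m) : R) * Num.sqrt (k`!%:R / (mfact m)%:R).
have mf : measurable_fun [set: dim.-tuple RM] (f : _ -> RM).
  apply: measurable_funM; last exact: measurable_cst.
  exact: measurable_tnth.
rewrite (_ : _ \o _ = f); first exact: mf.
by apply/funext => c; exact: hcoeff_of_coords.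
Qed.

Lemma measurable_bombieri_norm : measurable_fun [set: hpoly R n k]
  (@bombieri_norm R n k : hpoly R n k -> R).
Proof.
apply: (@measurableT_comp _ _ _ _ _ _ (@Num.sqrt R)).
  exact: continuous_measurable_fun (@sqrt_continuous R).
apply: measurable_sum => m; apply: measurable_funM; last exact: measurable_cst.
by apply: measurable_funX; exact: measurable_hcoeff.
Qed.

End HpolyFacts.

Lemma hpoly_dimE n k : hpoly_dim n.+1 k = 'C((n + k)%N, k).
Proof.
rewrite (addnC n k) -(mpoly.size_basis n k) /hpoly_dim cardE.
rewrite -(size_map (@multinom_of_mindex n.+1 k)); apply/perm_size/uniq_perm.
- by rewrite map_inj_uniq ?enum_uniq// => m m' mm'; exact/val_inj/val_inj.
- exact: mpoly.uniq_basis.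
move=> m; rewrite -mpoly.basis_cover; apply/mapP/idP => [[m' _ ->]|mk].
  exact: (valP m').
have mk' : (mdeg m < k.+1)%N by rewrite (eqP mk).
by exists (exist _ (BMultinom mk') mk) => //; rewrite mem_enum.
Qed.

Section Simplex.
Variable R : realType.

Definition dotv n (u v : 'rV[R]_n) : R := \sum_i u 0 i * v 0 i.

(* The norm that MathComp-Analysis puts on row vectors is the sup norm. *)
Definition l2norm n (u : 'rV[R]_n) : R := Num.sqrt (dotv u u).

Definition std_simplex n : set 'rV[R]_n.+1 :=
  [set x | (forall i, 0 <= x 0 i) /\ \sum_i x 0 i = 1].

Definition barycenter n : 'rV[R]_n.+1 := const_mx n.+1%:R^-1.

Arguments std_simplex : clear implicits.

Definition zsimplex n : set 'rV[R]_n.+1 :=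
  [set x - barycenter n | x in std_simplex n].

Arguments zsimplex : clear implicits.

Definition zhyperplane n : set 'rV[R]_n.+1 := [set x | \sum_i x 0 i = 0].
Arguments zhyperplane : clear implicits.

Definition vertex n (i : 'I_n.+1) : 'rV[R]_n.+1 :=
  delta_mx 0 i - barycenter n.

Definition convex_hull n (F : 'I_n.+1 -> 'rV[R]_n.+1) : set 'rV[R]_n.+1 :=
  [set \sum_i w 0 i *: F i | w in std_simplex n].

Lemma zsimplexE n : zsimplex n = convex_hull (@vertex n).
Proof.
apply: eq_imagel => x [_ x1].
under eq_bigr do rewrite /vertex scalerBr.
by rewrite sumrB -row_sum_delta -scaler_suml x1 scale1r.
Qed.

(* [phi] identifies the hyperplane with R^n by a linear isometry (an isometry
   between spaces of the same dimension is onto); its values off the hyperplane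
   play no role. *)
Definition isometry_on_zhyperplane n
    (phi : {linear 'rV[R]_n.+1 -> 'rV[R]_n}) : Prop :=
  forall x, zhyperplane n x -> l2norm (phi x) = l2norm x.

Lemma isometry_on_zhyperplane_exists n :
  exists phi, @isometry_on_zhyperplane n phi.
Proof.
pose s : R := Num.sqrt n.+1%:R.
pose c : R := (1 + s)^-1.
pose f (x : 'rV[R]_n.+1) : 'rV[R]_n := \row_j (x 0 (lift 0 j) - c * x 0 0).
have fL : linear f.
  by move=> a x y; apply/rowP => j; rewrite !mxE; ring.
pose fHB := GRing.isLinear.Build _ _ _ _ f fL.
pose phi : {linear 'rV[R]_n.+1 -> 'rV[R]_n} := HB.pack f fHB.
exists phi => x /= x0; rewrite -/(f x); congr Num.sqrt; rewrite /dotv [RHS]big_ord_recl.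
have {}x0 : \sum_(j < n) x 0 (lift 0 j) = - x 0 0.
  by apply/eqP; rewrite -addr_eq0 addrC; move/eqP: x0; rewrite big_ord_recl.
have s0 : 0 <= s by exact: sqrtr_ge0.
have s2 : s ^+ 2 = n%:R + 1 by rewrite sqr_sqrtr ?ler0n// -natr1.
have cE : c ^+ 2 * n%:R + 2 * c = 1.
  have -> : n%:R = s ^+ 2 - 1 by rewrite s2 addrK.
  rewrite /c; field; lra.
have key (u v t : R) : (v - t * u) * (v - t * u) =
  v * v - 2 * t * u * v + (t * u) ^+ 2 by ring.
transitivity (\sum_(j < n) x 0 (lift 0 j) * x 0 (lift 0 j)
    - 2 * c * x 0 0 * (\sum_(j < n) x 0 (lift 0 j))
    + c ^+ 2 * n%:R * x 0 0 ^+ 2).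
  rewrite mulr_sumr -sumrB /f.
  have -> : c ^+ 2 * n%:R * x 0 0 ^+ 2 = \sum_(j < n) (c * x 0 0) ^+ 2.
    by rewrite sumr_const card_ord -mulr_natr; ring.
  by rewrite -big_split; apply: eq_bigr => j _; rewrite /= !mxE /= key.
rewrite x0 [RHS]addrC -addrA; congr +%R.
have -> : c ^+ 2 * n%:R = 1 - 2 * c by rewrite -[LHS](addrK (2 * c)) cE.
move: (x 0 0) => y; clearbody c; ring.
Qed.

Definition gradient n (P : mpoly n R) (a : 'rV[R]_n) : 'rV[R]_n :=
  \row_i meval (a 0) (mderiv i P).

Definition rel_max_at n k (phi : 'rV[R]_n.+1 -> 'rV[R]_n) (i : 'I_n.+1) :
    set (hpoly R n k) :=
  [set P | forall j, j != i ->
    let a := phi (vertex i) in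
    let b := phi (vertex j) in
    let v := (l2norm (a - b))^-1 *: (a - b) in
    0 < dotv (gradient P a) v].
End Simplex.
Arguments rel_max_at {R n} k phi i.

Section GaussTotalMass.
Variable R : realType.
Local Notation RM := (measurableTypeR R).

Definition tuple_gauss n (t : n.-tuple RM) : R :=
  expR (- ((\sum_i (tnth t i : R) ^+ 2) / 2)).

Lemma measurable_tuple_gauss n :
  measurable_fun [set: n.-tuple RM] (EFin \o @tuple_gauss n).
Proof.
apply/measurable_EFinP; apply: (measurableT_comp (@measurable_expR R)).
apply: measurable_funN; apply: measurable_funM; last exact: measurable_cst.
apply: measurable_sum => i; apply: measurable_funX; exact: measurable_tnth.
Qed.

Lemma integral_gauss1 :
  (\int[lebesgue_measure]_x (expR (- ((x : R) ^+ 2 / 2)))%:E =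
   (Num.sqrt (2 * pi))%:E :> \bar R)%E.
Proof.
have := @integral_normal_pdf R 0 1.
under eq_integral do rewrite normal_pdfE ?oner_eq0// EFinM.
rewrite /normal_peak /normal_fun expr1n mul1r.
rewrite ge0_integralZl//; last first.
  apply/measurable_EFinP; have := @measurable_normal_fun R 0 1.
  by rewrite /normal_fun expr1n.
move=> h.
have s0 : Num.sqrt (pi *+ 2) != 0 :> R.
  by rewrite gt_eqF// sqrtr_gt0 pmulrn_lgt0// pi_gt0.
rewrite (_ : 2 * pi = pi *+ 2 :> R); last by rewrite mulr_natl.
transitivity ((Num.sqrt (pi *+ 2))%:E * 1%E : \bar R)%E; last by rewrite mule1.
rewrite -h muleA -EFinM divff// mul1e.
by apply: eq_integral => x _; rewrite subr0 mulNr.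
Qed.

Lemma integral_tuple_gauss n :
  (\int[lebesgue_tuple R n]_t (tuple_gauss t)%:E =
   (Num.sqrt (2 * pi) ^+ n)%:E)%E.
Proof.
elim: n => [|n ih].
  rewrite integral_dirac//; last exact: measurable_tuple_gauss.
  by rewrite diracT mul1e /tuple_gauss big_ord0 mul0r oppr0 expR0 expr0.
rewrite /= /lebesgue_cons ge0_integral_pushforward//; last 3 first.
- exact: measurable_tuple_cons.
- exact: measurable_tuple_gauss.
- by move=> x _; rewrite lee_fin expR_ge0.
rewrite fubini_tonelli1/=; last 2 first.
- apply: (measurableT_comp (measurable_tuple_gauss (n := n.+1))).
  exact: measurable_tuple_cons.
- by move=> x; rewrite lee_fin expR_ge0.
rewrite /fubini_F /=.
transitivity (\int[lebesgue_measure]_x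
   ((expR (- ((x : R) ^+ 2 / 2)))%:E * (Num.sqrt (2 * pi) ^+ n)%:E) : \bar R)%E.
  apply: eq_integral => x _; rewrite -ih -ge0_integralZl//; last 2 first.
  - exact: measurable_tuple_gauss.
  - by move=> t _; rewrite lee_fin expR_ge0.
  apply: eq_integral => t _; rewrite -EFinM -expRD /tuple_gauss.
  congr (expR _)%:E; rewrite big_ord_recl/= -opprD -mulrDl.
  congr (- ((_ + _) / 2)); apply: eq_bigr => i _.
  by congr (_ ^+ 2); exact: tnthS.
rewrite ge0_integralZr//; last first.
- apply/measurable_EFinP; apply: (measurableT_comp (@measurable_expR R)).
  apply: measurable_funN; apply: measurable_funM; last exact: measurable_cst.
  exact: measurable_funX.
by rewrite integral_gauss1 exprS EFinM.
Qed.

Lemma gaussW_setT n k : gaussW [set: hpoly R n k] = 1%E.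
Proof.
rewrite /gaussW /hpoly_lebesgue ge0_integral_pushforward//; last 2 first.
- exact: measurable_hpoly_of_coords.
- apply/measurable_EFinP; apply: (measurableT_comp (@measurable_expR R)).
  apply: measurable_funN; apply: measurable_funM; last exact: measurable_cst.
  by apply: measurable_funX; exact: measurable_bombieri_norm.
rewrite preimage_setT.
transitivity (((2 * pi) `^ (- ((hpoly_dim n k)%:R / 2)))%:E *
  \int[lebesgue_tuple R (hpoly_dim n k)]_t (tuple_gauss t)%:E)%E.
  congr *%E; apply: eq_integral => t _ /=.
  rewrite bombieri_norm_of_coords sqr_sqrtr//.
  by apply: sumr_ge0 => i _; exact: sqr_ge0.
have p0 : 0 < 2 * pi :> R by rewrite mulr_gt0// pi_gt0.
rewrite integral_tuple_gauss -EFinM -powR12_sqrt ?ltW// -powR_mulrn ?powR_ge0//.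
rewrite -powRrM -powRD; last by rewrite (gt_eqF p0) implybT.
by rewrite (mulrC 2^-1) addNr powRr0.
Qed.

End GaussTotalMass.

(* Main.v *)
From HB Require Import structures.
From mathcomp.multinomials Require Import -(notations) mpoly.
Require Import Defs.
From mathcomp Require Import all_boot all_order all_algebra.
From mathcomp Require Import all_classical all_reals all_analysis.
From mathcomp Require Import measurable_realfun ring lra.
Import Order.TTheory GRing.Theory Num.Theory.
Import numFieldNormedType.Exports.
Local Open Scope classical_set_scope.
Local Open Scope ring_scope.

Set Implicit Arguments.
Unset Strict Implicit.
Unset Printing Implicit Defensive.

(** Only the Laplace transform [E exp <x, c> = exp (|x|^2 / 2)] of the standard
    Gaussian measure is used.  Euler's identity [dP/da (a) = k P(a)] turns the
    derivative of [P] at the vertex [a_i] in the direction [a_i - a_j] into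
    [G_i - H_ij], where [G_i = k P(a_i)] and [H_ij] is the derivative of [P] at
    [a_i] in the direction [a_j].  The reproducing kernel [<x, y>^k] of the
    Bombieri inner product gives [Var G_i ~ k^2], [Var H_ij ~ k], and
    covariances of the [G_i] of order [n^-k].  So, with high probability, all
    [n (n + 1)] variables [H_ij] are at most about [sqrt (4 k ln n)], whereas the
    maximum of the almost independent [G_i] is about [k sqrt (2 ln n)].  For
    [k > 4] the following crude lower bound of this maximum is enough.  With
    [r = sqrt (ln (n + 1))], [mu = be r], [la = al r] and
    [4 / k < be^2 < al^2 < 1], the exponential sum [Z] of the [la G_i / k] is
    concentrated around its mean by Chebyshev's inequality, while the event
    [G_i <= k mu for all i] forces [Z <= Y] for another exponential sum [Y] of
    much smaller mean. *)

(** * Expectations under the standard Gaussian measure of R^d *)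

Section GaussianMean.
Variable R : realType.
Local Notation RM := (measurableTypeR R).

Definition linform d (x : 'I_d -> R) (t : d.-tuple RM) : R :=
  \sum_i x i * tnth t i.

Lemma measurable_linform d (x : 'I_d -> R) :
  measurable_fun [set: d.-tuple RM] (linform x).
Proof.
apply: measurable_sum => i; apply: measurable_funM; first exact: measurable_cst.
exact: measurable_tnth.
Qed.

Lemma linformZ d (c : R) (x : 'I_d -> R) t :
  linform (fun j => c * x j) t = c * linform x t.
Proof. by rewrite /linform mulr_sumr; apply: eq_bigr => j _; rewrite mulrA. Qed.

Lemma linformD d (x y : 'I_d -> R) t :
  linform (fun j => x j + y j) t = linform x t + linform y t.
Proof.
by rewrite /linform -big_split; apply: eq_bigr => j _; rewrite mulrDl.
Qed.

(** Completing the square, [a x - x^2 / 2 = a^2 / 2 - (x - a)^2 / 2], turns the integrand into a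
    multiple of the normal density of mean [a] and variance 1. *)
Lemma integral_expR_gauss1 (a : R) :
  (\int[lebesgue_measure]_x (expR (a * x - (x : R) ^+ 2 / 2))%:E =
   (Num.sqrt (2 * pi) * expR (a ^+ 2 / 2))%:E :> \bar R)%E.
Proof.
have := @integral_normal_pdf R a 1.
under eq_integral do rewrite normal_pdfE ?oner_eq0// EFinM.
rewrite /normal_peak /normal_fun expr1n mul1r.
rewrite ge0_integralZl//; last first.
  apply/measurable_EFinP; have := @measurable_normal_fun R a 1.
  by rewrite /normal_fun expr1n.
move=> h.
have s0 : Num.sqrt (pi *+ 2) != 0 :> R.
  by rewrite gt_eqF// sqrtr_gt0 pmulrn_lgt0// pi_gt0.
rewrite (_ : 2 * pi = pi *+ 2 :> R); last by rewrite mulr_natl.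
transitivity ((Num.sqrt (pi *+ 2) * expR (a ^+ 2 / 2))%:E * 1%E : \bar R)%E;
  last by rewrite mule1.
rewrite -h muleA -EFinM mulrAC divff// mul1r -ge0_integralZl//; last first.
  apply/measurable_EFinP; have := @measurable_normal_fun R a 1.
  by rewrite /normal_fun expr1n.
apply: eq_integral => x _; rewrite -EFinM -expRD; congr (expR _)%:E.
by field.
Qed.

Lemma measurable_linform_gauss d (x : 'I_d -> R) :
  measurable_fun [set: d.-tuple RM]
    (fun t => (expR (linform x t) * tuple_gauss t)%:E).
Proof.
apply/measurable_EFinP; apply: measurable_funM.
  by apply: (measurableT_comp (@measurable_expR R)); exact: measurable_linform.
by apply/measurable_EFinP; exact: measurable_tuple_gauss.
Qed.

Lemma tuple_gauss_ge0 d (t : d.-tuple RM) : 0 <= tuple_gauss t.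
Proof. exact: expR_ge0. Qed.

Lemma integral_expR_linform d (x : 'I_d -> R) :
  (\int[lebesgue_tuple R d]_t (expR (linform x t) * tuple_gauss t)%:E =
   (Num.sqrt (2 * pi) ^+ d * expR (\sum_i x i ^+ 2 / 2))%:E)%E.
Proof.
elim: d => [|d ih] in x *.
  rewrite integral_dirac//; last exact: measurable_linform_gauss.
  rewrite diracT mul1e /tuple_gauss /linform !big_ord0 mul0r oppr0 expR0 expr0.
  by rewrite mul1r.
rewrite /= /lebesgue_cons ge0_integral_pushforward//; last 3 first.
- exact: measurable_tuple_cons.
- exact: measurable_linform_gauss.
- by move=> t _; rewrite lee_fin mulr_ge0 ?expR_ge0.
rewrite fubini_tonelli1/=; last 2 first.
- apply: (measurableT_comp (measurable_linform_gauss x)).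
  exact: measurable_tuple_cons.
- by move=> t; rewrite lee_fin mulr_ge0 ?expR_ge0.
rewrite /fubini_F /=.
pose y i := x (lift ord0 i).
transitivity (\int[lebesgue_measure]_z
   ((expR (x ord0 * z - (z : R) ^+ 2 / 2))%:E *
    (Num.sqrt (2 * pi) ^+ d * expR (\sum_i y i ^+ 2 / 2))%:E) : \bar R)%E.
  apply: eq_integral => z _; rewrite -ih -ge0_integralZl//; last 2 first.
  - exact: measurable_linform_gauss.
  - by move=> t _; rewrite lee_fin mulr_ge0 ?expR_ge0.
  apply: eq_integral => t _; rewrite -EFinM -!expRD /linform /=.
  congr (expR _)%:E; rewrite !big_ord_recl/=.
  under eq_bigr do rewrite tnthS.
  under [X in _ + - ((_ + X) / 2)]eq_bigr do rewrite tnthS.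
  by rewrite /tnth/=; field.
rewrite ge0_integralZr//; last first.
  apply/measurable_EFinP; apply: (measurableT_comp (@measurable_expR R)).
  apply: measurable_funB; first exact: measurable_funM.
  by apply: measurable_funM; last exact: measurable_cst; exact: measurable_funX.
rewrite integral_expR_gauss1 big_ord_recl expRD (exprS _ d) -EFinM; congr EFin.
exact: mulrACA.
Qed.

(** This is the expectation as a relation: it bundles measurability, nonnegativity and finiteness,
    so that all later estimates are between real numbers. The normalizing factor stays on the
    right-hand side. *)
Definition gauss_mean d (f : d.-tuple RM -> R) (m : R) : Prop :=
  [/\ measurable_fun [set: d.-tuple RM] f, forall t, 0 <= f t &
   (\int[lebesgue_tuple R d]_t (f t * tuple_gauss t)%:E =
    (Num.sqrt (2 * pi) ^+ d * m)%:E)%E].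

Lemma measurable_mul_gauss d (f : d.-tuple RM -> R) :
  measurable_fun [set: d.-tuple RM] f ->
  measurable_fun [set: d.-tuple RM] (fun t => (f t * tuple_gauss t)%:E).
Proof.
move=> mf; apply/measurable_EFinP; apply: measurable_funM => //.
by apply/measurable_EFinP; exact: measurable_tuple_gauss.
Qed.

Lemma gauss_mean_expR d (x : 'I_d -> R) :
  gauss_mean (expR \o linform x) (expR (\sum_i x i ^+ 2 / 2)).
Proof.
split; last exact: integral_expR_linform.
- by apply: (measurableT_comp (@measurable_expR R)); exact: measurable_linform.
- by move=> t; exact: expR_ge0.
Qed.

Lemma gauss_meanZ d (f : d.-tuple RM -> R) m c : 0 <= c ->
  gauss_mean f m -> gauss_mean (fun t => c * f t) (c * m).
Proof.
move=> c0 [mf f0 fm]; split.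
- by apply: measurable_funM => //; exact: measurable_cst.
- by move=> t; rewrite mulr_ge0.
under eq_integral do rewrite -mulrA EFinM.
rewrite ge0_integralZl//.
- by rewrite fm -EFinM mulrCA.
- exact: measurable_mul_gauss.
- by move=> t _; rewrite lee_fin mulr_ge0// tuple_gauss_ge0.
Qed.

Lemma gauss_meanD d (f g : d.-tuple RM -> R) m p :
  gauss_mean f m -> gauss_mean g p -> gauss_mean (fun t => f t + g t) (m + p).
Proof.
move=> [mf f0 fm] [mg g0 gp]; split.
- exact: measurable_funD.
- by move=> t; rewrite addr_ge0.
under eq_integral do rewrite mulrDl EFinD.
rewrite ge0_integralD//.
- by rewrite fm gp -EFinD -mulrDr.
- by move=> t _; rewrite lee_fin mulr_ge0// tuple_gauss_ge0.
- exact: measurable_mul_gauss.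
- by move=> t _; rewrite lee_fin mulr_ge0// tuple_gauss_ge0.
- exact: measurable_mul_gauss.
Qed.

Lemma gauss_mean_cst d c : 0 <= c -> gauss_mean (fun _ : d.-tuple RM => c) c.
Proof.
move=> c0; have h : gauss_mean (fun _ : d.-tuple RM => 1) 1.
  split => //; under eq_integral do rewrite mul1r.
  by rewrite integral_tuple_gauss mulr1.
by have := gauss_meanZ c0 h; rewrite mulr1.
Qed.

Lemma gauss_mean_expR_affine d (x : 'I_d -> R) (c e s : R) : 0 <= c ->
  s = \sum_i x i * x i ->
  gauss_mean (fun t => c * expR (linform x t - e)) (c * expR (s / 2 - e)).
Proof.
move=> c0 ->.
have -> : (fun t => c * expR (linform x t - e)) =
    fun t => c * expR (- e) * (expR \o linform x) t.
  by apply/funext => t; rewrite /= addrC expRD mulrA.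
rewrite addrC expRD mulrA mulr_suml; apply: gauss_meanZ.
  by rewrite mulr_ge0// expR_ge0.
under eq_bigr do rewrite -expr2.
exact: gauss_mean_expR.
Qed.

Lemma gauss_mean_sum d I (s : seq I) (P : pred I)
    (f : I -> d.-tuple RM -> R) m :
  (forall i, P i -> gauss_mean (f i) (m i)) ->
  gauss_mean (fun t => \sum_(i <- s | P i) f i t) (\sum_(i <- s | P i) m i).
Proof.
move=> fm; elim: s => [|i s ih].
  rewrite big_nil (_ : (fun t => _) = fun=> 0); first exact: gauss_mean_cst.
  by apply/funext => t; rewrite big_nil.
rewrite (_ : (fun t => _) = fun t =>
    if P i then f i t + \sum_(j <- s | P j) f j t
    else \sum_(j <- s | P j) f j t); last first.
  by apply/funext => t; rewrite big_cons.
rewrite big_cons; case: ifPn => // Pi.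
exact: gauss_meanD (fm _ Pi) ih.
Qed.

Lemma le_gauss_mean d (f g : d.-tuple RM -> R) m p :
  (forall t, f t <= g t) -> gauss_mean f m -> gauss_mean g p -> m <= p.
Proof.
move=> fg [mf f0 fm] [mg g0 gp].
have s0 : 0 < Num.sqrt (2 * pi) ^+ d :> R.
  by rewrite exprn_gt0// sqrtr_gt0 mulr_gt0// pi_gt0.
rewrite -(ler_pM2l s0) -lee_fin -fm -gp; apply: ge0_le_integral => //.
- by move=> t _; rewrite lee_fin mulr_ge0// tuple_gauss_ge0.
- exact: measurable_mul_gauss.
- exact: measurable_mul_gauss.
- by move=> t _; rewrite lee_fin ler_wpM2r// tuple_gauss_ge0.
Qed.

(** A real mean exists because the integral over [B] is at most the finite total mass. *)
Lemma gauss_mean_indic d (B : set (d.-tuple RM)) : measurable B ->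
  exists2 m, gauss_mean \1_B m &
   (\int[lebesgue_tuple R d]_(t in B) (tuple_gauss t)%:E =
    (Num.sqrt (2 * pi) ^+ d * m)%:E)%E.
Proof.
move=> mB.
have s0 : Num.sqrt (2 * pi) ^+ d != 0 :> R.
  by rewrite gt_eqF// exprn_gt0// sqrtr_gt0 mulr_gt0// pi_gt0.
set I := (\int[_]_(_ in _) _)%E.
have IE : (I = \int[lebesgue_tuple R d]_t (\1_B t * tuple_gauss t)%:E)%E.
  rewrite /I integral_mkcond; apply: eq_integral => t _.
  by rewrite /= patchE indicE; case: (t \in B); rewrite ?mul1r ?mul0r.
have I0 : (0 <= I)%E by apply: integral_ge0 => t _; rewrite lee_fin expR_ge0.
have Ile : (I <= (Num.sqrt (2 * pi) ^+ d)%:E)%E.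
  rewrite -integral_tuple_gauss; apply: ge0_subset_integral => //.
    exact: measurable_tuple_gauss.
  by move=> t _; rewrite lee_fin tuple_gauss_ge0.
have Ifin : I \is a fin_num.
  by rewrite ge0_fin_numE//; apply: le_lt_trans Ile _; rewrite ltry.
exists (fine I / Num.sqrt (2 * pi) ^+ d); last first.
  by rewrite mulrC divfK// fineK.
split; first exact: measurable_indic.
- by move=> t; rewrite indicE; case: (t \in B).
- by rewrite -IE mulrC divfK// fineK.
Qed.

(** The two indicators add up to the constant 1, so monotonicity of the mean applies in both
    directions. *)
Lemma gauss_meanC_indic d (A : set (d.-tuple RM)) m m' :
  gauss_mean \1_A m -> gauss_mean \1_(~` A) m' -> m + m' = 1.
Proof.
move=> Am Am'; have s := gauss_meanD Am Am'.
have c := @gauss_mean_cst d 1 ler01.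
have E t : \1_A t + \1_(~` A) t = 1 :> R.
  by rewrite !indicE in_setC; case: (t \in A); rewrite ?addr0 ?add0r.
apply/eqP; rewrite eq_le; apply/andP; split.
  by apply: (le_gauss_mean _ s c) => t; rewrite E.
by apply: (le_gauss_mean _ c s) => t; rewrite E.
Qed.

End GaussianMean.

(** * Directional derivatives and powers of linear forms *)

Section LinearFormPowers.
Variables (R : realType) (n : nat).
Implicit Types (a b : 'rV[R]_n) (m : multinom n) (p : mpoly n R).

Definition dirderiv a b p : R := dotv (gradient p a) b.

Lemma dirderivE a b p :
  dirderiv a b p = \sum_i meval (a 0) (mderiv i p) * b 0 i.
Proof. by apply: eq_bigr => i _; rewrite mxE. Qed.

Lemma dirderiv_is_linear a b : linear_for *%R (dirderiv a b).
Proof.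
move=> c p q; rewrite !dirderivE mulr_sumr -big_split; apply: eq_bigr => i _ /=.
by rewrite mderivD mderivZ mevalD mevalZ mulrDl mulrA.
Qed.

HB.instance Definition _ a b :=
  GRing.isLinear.Build R (mpoly n R) R *%R (dirderiv a b)
    (@dirderiv_is_linear a b).

Definition lin_mpoly a : mpoly n R := \sum_i a 0 i *: mpolyX R (mnm1 i).

Lemma meval_lin_mpoly a b : meval (b 0) (lin_mpoly a) = dotv a b.
Proof.
rewrite /lin_mpoly raddf_sum; apply: eq_bigr => i _ /=.
by rewrite mevalZ mevalXU.
Qed.

Lemma mderiv_lin_mpoly i a : mderiv i (lin_mpoly a) = mpolyC n (a 0 i).
Proof.
rewrite /lin_mpoly raddf_sum (bigD1 i)//= big1 => [|j ji].
  rewrite addr0 mderivZ mderivX mnmE eqxx scale1r.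
  rewrite (_ : mnm_sub _ _ = mnm0); first by rewrite mpolyX0 alg_mpolyC.
  by apply/mnmP => j; rewrite !mnmE subnn.
by rewrite mderivZ mderivX mnmE (negbTE ji) scale0r scaler0.
Qed.

Lemma mderiv_lin_mpolyX i a k :
  mderiv i (lin_mpoly a ^+ k.+1) = (k.+1%:R * a 0 i) *: lin_mpoly a ^+ k.
Proof.
elim: k => [|k ih].
  by rewrite expr1 mderiv_lin_mpoly expr0 mul1r alg_mpolyC.
rewrite exprS mderivM mderiv_lin_mpoly ih mul_mpolyC -scalerAr -exprS -scalerDl.
by congr (_ *: _); ring.
Qed.

Lemma lin_mpoly_homog a : lin_mpoly a \is ishomog1 1 mdeg.
Proof.
apply: rpred_sum => i _; apply: rpredZ; rewrite dhomogX; apply/eqP.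
exact: mdeg1.
Qed.

(** The case [m i = 0] is separate because [mnm_sub] truncates: it would return [m] itself. *)
Lemma mcoeffMXU p m i : mcoeff m (p * mpolyX R (mnm1 i)) =
  if m i == 0%N then 0 else mcoeff (mnm_sub m (mnm1 i)) p.
Proof.
case: ifPn => [/eqP mi|mi].
  apply/eqP; rewrite mcoeff_eq0 (perm_mem (msuppMX _ _)).
  apply/negP => /mapP [m' _ mE].
  by move: mi; rewrite mE mnmDE mnm1E eqxx.
by rewrite -{1}(@submK _ (mnm1 i) m) ?lep1mP// addmC mcoeffMX.
Qed.

Lemma mfact_sub1 m i : m i != 0%N ->
  mfact m = (m i * mfact (mnm_sub m (mnm1 i)))%N.
Proof.
move=> mi; rewrite /mfact (bigD1 i)// [in RHS](bigD1 i)//= mulnA.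
rewrite mnmBE mnm1E eqxx subn1; congr muln.
  by case: (m i) mi => // j _; rewrite factS.
by apply: eq_bigr => j ji; rewrite mnmBE mnm1E eq_sym (negbTE ji) subn0.
Qed.

Lemma dirderiv_mpolyX a b m : dirderiv a b (mpolyX R m) =
  \sum_i b 0 i * (m i)%:R * meval (a 0) (mpolyX R (mnm_sub m (mnm1 i))).
Proof.
rewrite dirderivE; apply: eq_bigr => i _.
by rewrite mderivX mevalZ; ring.
Qed.

(** Euler's identity for monomials. *)
Lemma dirderiv_mpolyX_self a m :
  dirderiv a a (mpolyX R m) = (mdeg m)%:R * meval (a 0) (mpolyX R m).
Proof.
rewrite dirderiv_mpolyX mdegE natr_sum mulr_suml; apply: eq_bigr => i _.
have [->|mi] := eqVneq (m i) 0%N; first by rewrite mulr0 !mul0r.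
rewrite -[in RHS](@submK _ (mnm1 i) m) ?lep1mP// mpolyXD mevalM mevalXU.
rewrite mnmDE mnmBE mnm1E eqxx subnK ?lt0n//; ring.
Qed.

(** Expand [lin_mpoly b] and use [m! = m_i (m - e_i)!] in each term. The formula for the [k]-th
    power is a hypothesis so that the lemma serves twice: with [b = a] as the induction step for
    that formula, and with arbitrary [b] for the representer of [dirderiv a b]. *)
Lemma mcoeff_lin_mpolyXM k a b m :
  (forall m', mdeg m' = k -> (mfact m')%:R * mcoeff m' (lin_mpoly a ^+ k) =
     k`!%:R * meval (a 0) (mpolyX R m')) ->
  mdeg m = k.+1 ->
  (mfact m)%:R * mcoeff m (lin_mpoly a ^+ k * lin_mpoly b) =
  k`!%:R * dirderiv a b (mpolyX R m).
Proof.
move=> ih mk; rewrite dirderiv_mpolyX /lin_mpoly -/(lin_mpoly a) mulr_sumr.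
rewrite mulr_sumr raddf_sum !mulr_sumr; apply: eq_bigr => i _ /=.
rewrite -scalerAr mcoeffZ mcoeffMXU; case: ifPn => [/eqP ->|mi].
  by rewrite !(mulr0, mul0r).
rewrite (mfact_sub1 mi) natrM.
have mk' : mdeg (mnm_sub m (mnm1 i)) = k.
  apply/eqP; rewrite -eqSS -mk -addn1 -(mdeg1 i) -mdegD submK//.
  by rewrite lep1mP.
have := ih _ mk'; set c := mcoeff _ _; set f := (mfact _)%:R; move=> h.
transitivity (b 0 i * (m i)%:R * (f * c)); first by ring.
by rewrite h; ring.
Qed.

(** The multinomial theorem, by induction on [k]: Euler's identity evaluates the derivative given by
    the previous lemma. *)
Lemma mcoeff_lin_mpolyX k a m : mdeg m = k ->
  (mfact m)%:R * mcoeff m (lin_mpoly a ^+ k) =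
  k`!%:R * meval (a 0) (mpolyX R m).
Proof.
elim: k m => [|k ih] m mk.
  have -> : m = mnm0 by apply/eqP; rewrite -mdeg_eq0 mk.
  rewrite mpolyX0 meval1 expr0 mcoeff1 eqxx !mulr1 /mfact.
  by rewrite big1// => i _; rewrite mnmE.
rewrite exprSr mcoeff_lin_mpolyXM// dirderiv_mpolyX_self mk factS natrM.
by ring.
Qed.

End LinearFormPowers.

(** * Covariances of directional derivatives of a random polynomial *)

Section GramMatrix.
Variables (R : realType) (n k : nat).
Local Notation RM := (measurableTypeR R).
Implicit Types (a b : 'rV[R]_n).

Definition dirderiv_coords a b (j : 'I_(hpoly_dim n k)) : R :=
  dirderiv a b (bombieri_basis R (enum_val j)).

Lemma dirderiv_of_coords a b t :
  dirderiv a b (@hpoly_of_coords R n k t) = linform (dirderiv_coords a b) t.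
Proof.
rewrite /hpoly_of_coords (raddf_sum (@mpoly_of_dhomog n R k)) raddf_sum /=.
rewrite /linform (reindex (@enum_rank (mindex n k))) /=; last first.
  exact/onW_bij/enum_rank_bij.
apply: eq_bigr => m _.
by rewrite linearZ/= /dirderiv_coords enum_rankK mulrC.
Qed.

Lemma dirderiv_basis a b (m : mindex n k) :
  dirderiv a b (bombieri_basis R m) =
  Num.sqrt (k`!%:R / (mfact m)%:R) * dirderiv a b (mpolyX R m).
Proof. by rewrite /bombieri_basis linearZ. Qed.

End GramMatrix.

Section MonomialExpansion.
Variables (R : realType) (n k : nat).
Implicit Types (p q : mpoly n R) (m : mindex n k).

Lemma mcoeff_sum_mindex (c : mindex n k -> R) m :
  mcoeff m (\sum_(m' : mindex n k) c m' *: mpolyX R m') = c m.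
Proof.
rewrite raddf_sum (bigD1 m)//= big1 => [|m' m'm].
  by rewrite addr0 mcoeffZ mcoeffX eqxx mulr1.
rewrite mcoeffZ mcoeffX (_ : (_ == _) = false) ?mulr0//.
by apply/negbTE; apply: contra m'm => /eqP e; apply/eqP/val_inj/val_inj.
Qed.

Lemma dhomog_eq p q :
  p \is ishomog1 k mdeg -> q \is ishomog1 k mdeg ->
  (forall m, mcoeff m p = mcoeff m q) -> p = q.
Proof.
move=> hp hq pq; apply/mpolyP => m.
have [mk|mk] := eqVneq (mdeg m) k; last first.
  by rewrite (dhomog_nemf_coeff hp mk) (dhomog_nemf_coeff hq mk).
have mk' : (mdeg m < k.+1)%N by rewrite mk.
have mk'' : mdeg (BMultinom mk') == k by rewrite /= mk.
exact: (pq (exist _ (BMultinom mk') mk'')).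
Qed.

Lemma hpolyE (P : hpoly R n k) :
  P = \sum_(m : mindex n k) hcoeff m P *: mpolyX R m :> mpoly n R.
Proof.
apply: dhomog_eq => [||m]; first exact: dhomog_is_dhomog.
  by apply: rpred_sum => m _; apply: rpredZ; exact: mindex_homog.
by rewrite mcoeff_sum_mindex.
Qed.

End MonomialExpansion.

(* The representer of [P |-> dP/db (a)] for the Bombieri inner product is the
   polynomial [k <a, x>^(k-1) <b, x>]. *)
Lemma representer_dirderiv (R : realType) n k (a b : 'rV[R]_n) :
  \sum_(j < hpoly_dim n k.+1)
     dirderiv_coords a b j *: (bombieri_basis R (enum_val j) : mpoly n R) =
  k.+1%:R *: (lin_mpoly a ^+ k * lin_mpoly b).
Proof.
transitivity (\sum_(m : mindex n k.+1)
    ((k.+1)`!%:R / (mfact m)%:R * dirderiv a b (mpolyX R m)) *: mpolyX R m).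
  rewrite (reindex (@enum_rank (mindex n k.+1))) /=; last first.
    exact/onW_bij/enum_rank_bij.
  apply: eq_bigr => m _.
  rewrite /dirderiv_coords enum_rankK dirderiv_basis scalerA mulrAC -expr2.
  by rewrite sqr_sqrtr ?divr_ge0.
apply: (@dhomog_eq _ _ k.+1) => [||m].
- by apply: rpred_sum => m _; apply: rpredZ; exact: mindex_homog.
- apply: rpredZ.
  have := dhomogM (dhomogMn k (lin_mpoly_homog a)) (lin_mpoly_homog b).
  by rewrite mul1n addn1.
rewrite mcoeff_sum_mindex mcoeffZ.
have f0 : (mfact m)%:R != 0 :> R by rewrite pnatr_eq0 -lt0n mfact_gt0.
apply: (mulfI f0); rewrite [RHS]mulrCA mcoeff_lin_mpolyXM//; last 2 first.
- by move=> m'; exact: mcoeff_lin_mpolyX.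
- exact/eqP/(valP m).
by rewrite factS natrM; field.
Qed.

(** The inner product of two functionals is the value of one at the representer of the other, so it
    suffices to differentiate [<a, x>^(k+1) <b, x>] at [a'] in the direction [b']. *)
Lemma dirderiv_gram (R : realType) n k (a b a' b' : 'rV[R]_n) :
  \sum_(j < hpoly_dim n k.+2) dirderiv_coords a b j * dirderiv_coords a' b' j =
  k.+2%:R * (k.+1%:R * dotv a a' ^+ k * dotv a b' * dotv b a' +
             dotv a a' ^+ k.+1 * dotv b b').
Proof.
transitivity (dirderiv a' b' (\sum_(j < hpoly_dim n k.+2)
     dirderiv_coords a b j *: (bombieri_basis R (enum_val j) : mpoly n R))).
  by rewrite raddf_sum; apply: eq_bigr => j _; rewrite /= linearZ.
rewrite representer_dirderiv linearZ /= dirderivE; congr *%R.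
transitivity (\sum_i
  ((k.+1%:R * dotv a a' ^+ k * dotv b a') * (a 0 i * b' 0 i) +
   dotv a a' ^+ k.+1 * (b 0 i * b' 0 i))).
  apply: eq_bigr => i _.
  rewrite mderivM mderiv_lin_mpolyX mderiv_lin_mpoly mevalD !mevalM mevalZ.
  by rewrite mevalC !rmorphXn/= !meval_lin_mpoly; ring.
by rewrite big_split/= -!mulr_sumr -/(dotv a b') -/(dotv b b'); ring.
Qed.

(** * Probability that every [g_i] is exceeded by some [h_ij] *)

Section MaximumBound.
Variables (R : realType) (n d : nat).
Local Notation RM := (measurableTypeR R).
Variables (g : 'I_n.+1 -> 'I_d -> R) (h : 'I_n.+1 -> 'I_n.+1 -> 'I_d -> R).
Variables (K sg rho v la mu : R).
Hypothesis K0 : 0 < K.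
Hypothesis mu0 : 0 <= mu.
Hypothesis mula : mu <= la.
Hypothesis gg : forall i, \sum_j g i j * g i j = K ^+ 2 * sg.
Hypothesis gg' : forall i i', i != i' ->
  \sum_j g i j * g i' j = K ^+ 2 * rho.
Hypothesis hh : forall i i', i != i' -> \sum_j h i i' j * h i i' j <= v.

Let M : R := n.+1%:R.
Let M0 : 0 < M. Proof. by rewrite ltr0n. Qed.

(* [Z] has mean 1; if all the [g_i] are at most [K mu], then [Z <= Y]; and
   [X >= 1] as soon as some [h_ij] exceeds [K mu]. *)
Let Z t : R :=
  \sum_i M^-1 * expR (la / K * linform (g i) t - la ^+ 2 * sg / 2).
Let Y t : R := \sum_i M^-1 *
  expR (mu / K * linform (g i) t - (la ^+ 2 * sg / 2 - (la - mu) * mu)).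
Let X t : R := \sum_i \sum_(j | i != j)
  expR (mu * linform (h i j) t - K * mu ^+ 2).

Let mean_avg (c e m : R) : m = expR ((c / K) ^+ 2 * (K ^+ 2 * sg) / 2 - e) ->
  gauss_mean (fun t => \sum_i M^-1 * expR (c / K * linform (g i) t - e)) m.
Proof.
move=> ->; set E := expR _.
have -> : E = \sum_(i < n.+1) M^-1 * E.
  by rewrite sumr_const card_ord -(mulr_natl (_ * E)) mulVKf// gt_eqF.
apply: gauss_mean_sum => i _; under eq_fun do rewrite -linformZ.
apply: gauss_mean_expR_affine; first by rewrite invr_ge0 ltW.
by under eq_bigr do rewrite mulrACA; rewrite -mulr_sumr gg expr2.
Qed.

Let meanZ : gauss_mean Z 1.
Proof.
by apply: mean_avg; rewrite -[LHS]expR0; congr expR; field; rewrite gt_eqF.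
Qed.

Let meanY : gauss_mean Y
  (expR (mu ^+ 2 * sg / 2 - (la ^+ 2 * sg / 2 - (la - mu) * mu))).
Proof. by apply: mean_avg; congr expR; field; rewrite gt_eqF. Qed.

(** An exponential Markov bound for each [h_ij], summed over at most [M^2] pairs. *)
Let meanX : exists2 m, gauss_mean X m &
  m <= M ^+ 2 * expR (mu ^+ 2 * v / 2 - K * mu ^+ 2).
Proof.
exists (\sum_i \sum_(j | i != j)
  1 * expR (mu ^+ 2 * (\sum_l h i j l * h i j l) / 2 - K * mu ^+ 2)).
  apply: gauss_mean_sum => i _; apply: gauss_mean_sum => j ij.
  rewrite (_ : (fun t => _) = fun t =>
      1 * expR (linform (fun l => mu * h i j l) t - K * mu ^+ 2)); last first.
    by apply/funext => t; rewrite linformZ mul1r.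
  apply: gauss_mean_expR_affine => //.
  under [RHS]eq_bigr do rewrite mulrACA.
  by rewrite -mulr_sumr expr2.
set e := expR _.
apply: (@le_trans _ _ (\sum_(i < n.+1) \sum_(j < n.+1) e)); last first.
  rewrite !sumr_const !card_ord -(mulr_natl e) -(mulr_natl (_ * e)) mulrA.
  by rewrite expr2.
apply: ler_sum => i _.
rewrite [leRHS](bigID (fun j => i != j)) /= -[leLHS]addr0.
apply: lerD; last by apply: sumr_ge0 => j _; exact: expR_ge0.
apply: ler_sum => j ij; rewrite mul1r ler_expR lerD2r ler_pM2r ?invr_gt0//.
by rewrite ler_wpM2l ?sqr_ge0 ?hh.
Qed.

(** In the expanded square, each of the [M] diagonal terms has mean [M^-2 exp (la^2 sg)] and each
    off-diagonal term [M^-2 exp (la^2 rho)]; the latter are counted as [M^2] terms. *)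
Let meanZ2 : exists2 m, gauss_mean (fun t => Z t ^+ 2) m &
  m <= expR (la ^+ 2 * sg) / M + expR (la ^+ 2 * rho).
Proof.
pose cov (i j : 'I_n.+1) := if i == j then sg else rho.
pose m i j :=
  M^-2 * expR (la ^+ 2 * (2 * sg + 2 * cov i j) / 2 - la ^+ 2 * sg).
exists (\sum_i \sum_j m i j).
  rewrite (_ : (fun t => _) = fun t => \sum_i \sum_j M^-2 *
      expR (linform (fun l => la / K * (g i l + g j l)) t - la ^+ 2 * sg));
    last first.
    apply/funext => t; rewrite expr2 /Z mulr_suml; apply: eq_bigr => i _.
    rewrite mulr_sumr; apply: eq_bigr => j _.
    rewrite linformZ linformD mulrACA -expRD -expr2 exprVn.
    by congr (_ * expR _); field; rewrite gt_eqF.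
  apply: gauss_mean_sum => i _; apply: gauss_mean_sum => j _.
  apply: gauss_mean_expR_affine; first by rewrite invr_ge0 sqr_ge0.
  transitivity ((la / K) ^+ 2 * (\sum_l g i l * g i l + \sum_l g j l * g j l +
    2 * \sum_l g i l * g j l)).
    rewrite !gg /cov; have [->|ij] := eqVneq i j.
      by rewrite gg; field; rewrite gt_eqF.
    by rewrite gg'//; field; rewrite gt_eqF.
  by rewrite !mulr_sumr -!big_split mulr_sumr; apply: eq_bigr => l _ /=; ring.
have mij i j : i != j -> m i j = M^-2 * expR (la ^+ 2 * rho).
  by move=> ij; rewrite /m /cov (negbTE ij); congr (_ * expR _); field.
have mii i : m i i = M^-2 * expR (la ^+ 2 * sg).
  by rewrite /m /cov eqxx; congr (_ * expR _); field.
apply: (@le_trans _ _ (\sum_(i < n.+1) (M^-2 * expR (la ^+ 2 * sg) +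
    \sum_(j < n.+1) M^-2 * expR (la ^+ 2 * rho)))).
  apply: ler_sum => i _; rewrite (bigD1 i)//= mii lerD2l [leRHS](bigD1 i)//=.
  rewrite -[leLHS]add0r lerD//.
    by rewrite mulr_ge0 ?expR_ge0// invr_ge0 sqr_ge0.
  by apply: ler_sum => j ij; rewrite mij// eq_sym.
rewrite !sumr_const !card_ord -(mulr_natl (_ * expR (_ * rho))).
rewrite -(mulr_natl (_ + _)) -/M le_eqVlt; apply/orP; left; apply/eqP.
by field; rewrite gt_eqF.
Qed.

(** This is [1_B <= X + 4 (Z - 1)^2 + 2 Y], with the square expanded and [8 Z] moved to the left so
    that both sides are sums of nonnegative functions, as [gauss_mean] demands. *)
Let indic_le t (B : set (d.-tuple RM)) :
  (B t -> forall i, exists2 j, i != j &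
     linform (g i) t <= linform (h i j) t) ->
  \1_B t + 8 * Z t <= X t + (4 * Z t ^+ 2 + (4 + 2 * Y t)).
Proof.
move=> Bt.
have X0 : 0 <= X t.
  by apply: sumr_ge0 => i _; apply: sumr_ge0 => j _; exact: expR_ge0.
have Y0 : 0 <= Y t.
  by apply: sumr_ge0 => i _; rewrite mulr_ge0 ?expR_ge0// invr_ge0 ltW.
have Z1 : 8 * Z t <= 4 * Z t ^+ 2 + 4.
  by have := sqr_ge0 (Z t - 1); nra.
rewrite indicE; have [/set_mem/Bt {}Bt|_] := boolP (t \in B); last first.
  by rewrite /=; lra.
rewrite /=.
have [/existsP[i /existsP[j /andP[ij hT]]]|] := boolP
    [exists i, [exists j, (i != j) && (K * mu < linform (h i j) t)]].
  suff X1 : 1 <= X t by lra.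
  rewrite /X (bigD1 i)//= (bigD1 j)//= -addrA -[leLHS]addr0 lerD//.
    rewrite -expR0 ler_expR subr_ge0 expr2 mulrA mulrC.
    by rewrite ler_wpM2l// ltW.
  rewrite addr_ge0//; first by apply: sumr_ge0 => l _; exact: expR_ge0.
  by apply: sumr_ge0 => l _; apply: sumr_ge0 => l' _; exact: expR_ge0.
move=> /existsPn noH.
have gT i : linform (g i) t <= K * mu.
  have [j ij gh] := Bt i; apply: le_trans gh _.
  have /existsPn /(_ j) := noH i.
  by rewrite ij /= -leNgt.
suff ZY : Z t <= Y t.
  (* Chebyshev: 4 (Z - 1)^2 >= 1 unless Z >= 1/2, and then 2 Y >= 1. *)
  have := sqr_ge0 (Z t - 1); have [Zl|Zl] := leP (Z t) (1 / 2); nra.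
apply: ler_sum => i _; apply: ler_wpM2l; first by rewrite invr_ge0 ltW.
rewrite ler_expR opprD opprK [leRHS]addrCA -[leLHS]addrC lerD2l.
(* Lowering the slope from [la / K] to [mu / K] costs [(la - mu) / K] times [g_i], which is at most
   [(la - mu) mu] on this event; this is the correction in the exponent of [Y]. *)
have cs : 0 <= (la - mu) / K by rewrite divr_ge0 ?subr_ge0// ltW.
have := ler_wpM2l cs (gT i).
have -> : (la - mu) / K * (K * mu) = (la - mu) * mu.
  by field; rewrite gt_eqF.
by rewrite !mulrBl -!mulrA lerBlDl.
Qed.

(** Take means in [indic_le]: as [Z] has mean 1, the terms in [Z] contribute four times its
    variance. *)
Lemma gauss_mean_all_exceeded_le (B : set (d.-tuple RM)) m :
  (forall t, B t -> forall i, exists2 j, i != j &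
     linform (g i) t <= linform (h i j) t) ->
  gauss_mean \1_B m ->
  m <= M ^+ 2 * expR (mu ^+ 2 * v / 2 - K * mu ^+ 2) +
    4 * (expR (la ^+ 2 * sg) / M + expR (la ^+ 2 * rho) - 1) +
    2 * expR (mu ^+ 2 * sg / 2 - (la ^+ 2 * sg / 2 - (la - mu) * mu)).
Proof.
move=> BP Bm.
have [mX mXX mX_le] := meanX; have [mZ mZZ mZ_le] := meanZ2.
have lhs := gauss_meanD Bm (gauss_meanZ (ler0n R 8) meanZ).
have m4Y := gauss_meanD (gauss_mean_cst d (ler0n R 4))
  (gauss_meanZ (ler0n R 2) meanY).
have rhs := gauss_meanD mXX
  (gauss_meanD (gauss_meanZ (ler0n R 4) mZZ) m4Y).
have := le_gauss_mean (fun t => indic_le (BP t)) lhs rhs.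
move: mX_le mZ_le; set E1 := M ^+ 2 * _; set E2 := expR _ / M.
by set E3 := expR _; set E4 := expR _; lra.
Qed.

End MaximumBound.

(** * Inner products of the vertices and the relative maximum condition *)

Section SimplexGeometry.
Variable R : realType.

Lemma dotvDl n (u v w : 'rV[R]_n) : dotv (u + v) w = dotv u w + dotv v w.
Proof.
by rewrite /dotv -big_split; apply: eq_bigr => i _; rewrite mxE mulrDl.
Qed.

Lemma dotvC n (u v : 'rV[R]_n) : dotv u v = dotv v u.
Proof. by apply: eq_bigr => i _; rewrite mulrC. Qed.

Lemma dotvZl n c (u v : 'rV[R]_n) : dotv (c *: u) v = c * dotv u v.
Proof.
by rewrite /dotv mulr_sumr; apply: eq_bigr => i _; rewrite mxE mulrA.
Qed.

Lemma dotvBl n (u v w : 'rV[R]_n) : dotv (u - v) w = dotv u w - dotv v w.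
Proof. by rewrite -scaleN1r dotvDl dotvZl mulN1r. Qed.

Lemma dotvv_ge0 n (u : 'rV[R]_n) : 0 <= dotv u u.
Proof. by apply: sumr_ge0 => i _; rewrite -expr2 sqr_ge0. Qed.

Lemma dotv_sqrD n (u v : 'rV[R]_n) :
  dotv (u + v) (u + v) = dotv u u + dotv v v + 2 * dotv u v.
Proof.
by rewrite dotvDl !(dotvC _ (u + v)) !dotvDl (dotvC v u); ring.
Qed.

(** Polarization; the hyperplane is closed under addition. *)
Lemma isometry_dotv n (phi : {linear 'rV[R]_n.+1 -> 'rV[R]_n}) x y :
  isometry_on_zhyperplane phi -> zhyperplane x -> zhyperplane y ->
  dotv (phi x) (phi y) = dotv x y.
Proof.
move=> hphi x0 y0.
have sq z : zhyperplane z -> dotv (phi z) (phi z) = dotv z z.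
  move=> /hphi /(congr1 (fun c => c ^+ 2)).
  by rewrite !sqr_sqrtr// dotvv_ge0.
have xy0 : zhyperplane (x + y).
  rewrite /zhyperplane/=; under eq_bigr do rewrite mxE.
  by rewrite big_split/= x0 y0 addr0.
have := sq _ xy0; rewrite linearD !dotv_sqrD !sq//.
by move=> /addrI /mulfI; apply; rewrite pnatr_eq0.
Qed.

Lemma sum_vertex n (i : 'I_n.+1) : zhyperplane (vertex R i).
Proof.
rewrite /zhyperplane/= /vertex; under eq_bigr do rewrite !mxE eqxx /=.
rewrite sumrB sumr_const card_ord -(mulr_natr n.+1%:R^-1) mulVf ?pnatr_eq0//.
rewrite (bigD1 i)//= eqxx big1 ?addr0 ?subrr// => j /negbTE.
by rewrite eq_sym => ->.
Qed.

(** The barycenter is orthogonal to the hyperplane, so only the [i]-th coordinate of the second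
    vertex remains. *)
Lemma dotv_vertex n (i j : 'I_n.+1) :
  dotv (vertex R i) (vertex R j) = (i == j)%:R - n.+1%:R^-1.
Proof.
rewrite {1}/vertex dotvBl.
have -> : dotv (barycenter R n) (vertex R j) = 0.
  rewrite /dotv; under eq_bigr do rewrite mxE.
  by rewrite -mulr_sumr sum_vertex mulr0.
rewrite subr0 /dotv (bigD1 i)//= big1 => [|l /negbTE li].
  by rewrite !mxE !eqxx mul1r addr0.
by rewrite mxE li andbF mul0r.
Qed.

Lemma dirderivBr n (a b c : 'rV[R]_n) p :
  dirderiv a (b - c) p = dirderiv a b p - dirderiv a c p.
Proof. by rewrite /dirderiv dotvC dotvBl !(dotvC _ (gradient p a)). Qed.

Lemma dotv_sqrB n (u v : 'rV[R]_n) :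
  dotv (u - v) (u - v) = dotv u u + dotv v v - 2 * dotv u v.
Proof.
by rewrite dotvBl !(dotvC _ (u - v)) !dotvBl (dotvC v u); ring.
Qed.

Lemma isometry_dotv_vertex n (phi : {linear 'rV[R]_n.+1 -> 'rV[R]_n}) i j :
  isometry_on_zhyperplane phi ->
  dotv (phi (vertex R i)) (phi (vertex R j)) = (i == j)%:R - n.+1%:R^-1.
Proof.
by move=> hphi; rewrite isometry_dotv ?dotv_vertex//; exact: sum_vertex.
Qed.

(** Distinct vertices are at squared distance 2, so normalizing the direction does not change the
    sign of the derivative. *)
Lemma rel_max_atE n k (phi : {linear 'rV[R]_n.+1 -> 'rV[R]_n}) i :
  isometry_on_zhyperplane phi ->
  rel_max_at k phi i = [set P | forall j, j != i ->
    dirderiv (phi (vertex R i)) (phi (vertex R j)) P <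
    dirderiv (phi (vertex R i)) (phi (vertex R i)) P].
Proof.
move=> hphi.
have norm_gt0 j : j != i -> 0 < l2norm (phi (vertex R i) - phi (vertex R j)).
  move=> ji; rewrite sqrtr_gt0 dotv_sqrB !isometry_dotv_vertex// !eqxx.
  rewrite [i == j]eq_sym (negbTE ji) [ltRHS](_ : _ = 2)//=; ring.
apply/seteqP; split => P /= PP j ji; have := PP _ ji; clear PP.
all: cbv zeta; rewrite dotvC dotvZl (dotvC _ (gradient P _)).
all: rewrite -/(dirderiv _ _ P) dirderivBr.
all: by rewrite pmulr_rgt0 ?subr_gt0// invr_gt0 norm_gt0.
Qed.

End SimplexGeometry.

(** * Measurability, and [gaussW] as a Gaussian mean in coordinates *)

Section GaussianMass.
Variables (R : realType) (n k : nat).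
Local Notation RM := (measurableTypeR R).

Lemma measurable_dirderiv (a b : 'rV[R]_n) :
  measurable_fun [set: hpoly R n k] (fun P => dirderiv a b P : RM).
Proof.
rewrite (_ : (fun P => _) =
    fun P => \sum_(m : mindex n k) hcoeff m P * dirderiv a b (mpolyX R m)).
  apply: measurable_sum => m.
  apply: measurable_funM; last exact: measurable_cst.
  exact: measurable_hcoeff.
apply/funext => P; rewrite {1}hpolyE raddf_sum.
by apply: eq_bigr => m _; rewrite /= linearZ.
Qed.

(** In coordinates the Bombieri norm is Euclidean, and the prefactor of [gaussW] cancels the power
    of [sqrt (2 pi)] in [gauss_mean]. *)
Lemma gaussW_gauss_mean (B : set (hpoly R n k)) : measurable B ->
  exists2 m, gauss_mean \1_(@hpoly_of_coords R n k @^-1` B) m &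
    gaussW B = m%:E.
Proof.
move=> mB.
have mB' : measurable (@hpoly_of_coords R n k @^-1` B).
  by rewrite -[X in measurable X]setTI; exact: measurable_hpoly_of_coords.
have [m Bm mE] := gauss_mean_indic mB'; exists m => //.
rewrite /gaussW /hpoly_lebesgue ge0_integral_pushforward//; last 2 first.
- exact: measurable_hpoly_of_coords.
- apply/measurable_EFinP; apply: (measurableT_comp (@measurable_expR R)).
  apply: measurable_funN; apply: measurable_funM; last exact: measurable_cst.
  apply: measurable_funX.
  by apply: measurable_funS (@measurable_bombieri_norm R n k).
transitivity (((2 * pi) `^ (- ((hpoly_dim n k)%:R / 2)))%:E *
  \int[lebesgue_tuple R (hpoly_dim n k)]_(t in @hpoly_of_coords R n k @^-1` B)
    (tuple_gauss t)%:E)%E.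
  congr *%E; apply: eq_integral => t _ /=.
  rewrite bombieri_norm_of_coords sqr_sqrtr//.
  by apply: sumr_ge0 => i _; exact: sqr_ge0.
have p0 : 0 < 2 * pi :> R by rewrite mulr_gt0// pi_gt0.
rewrite mE -EFinM mulrA -powR12_sqrt ?ltW// -powR_mulrn ?powR_ge0//.
rewrite -powRrM -powRD; last by rewrite (gt_eqF p0) implybT.
by rewrite (mulrC 2^-1) addNr powRr0 mul1r.
Qed.

End GaussianMass.

Lemma measurable_bigcup_rel_max_at (R : realType) n k
    (phi : {linear 'rV[R]_n.+1 -> 'rV[R]_n}) : isometry_on_zhyperplane phi ->
  measurable (\bigcup_(i : 'I_n.+1) rel_max_at k phi i).
Proof.
move=> hphi; apply: fin_bigcup_measurable => // i _.
have -> : rel_max_at k phi i = \bigcap_(j in [set j | j != i])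
  [set P : hpoly R n k | dirderiv (phi (vertex R i)) (phi (vertex R j)) P <
    dirderiv (phi (vertex R i)) (phi (vertex R i)) P].
  by rewrite rel_max_atE.
apply: fin_bigcap_measurable => [|j _]; first exact: finite_finset.
rewrite -[X in measurable X]setTI; apply: measurable_fun_ltr => //.
all: exact: measurable_dirderiv.
Qed.

(** * Explicit bound on the failure probability *)

Lemma one_sub_expr_le (R : realDomainType) (x : R) k : 0 <= x <= 1 ->
  1 - (1 - x) ^+ k <= k%:R * x.
Proof.
move=> /andP[x0 x1]; elim: k => [|k ih]; first by rewrite expr0 subrr mul0r.
rewrite exprS -natr1 [leRHS]mulrDl mulrBl !mul1r.
have y1 : (1 - x) ^+ k <= 1 by rewrite exprn_ile1 ?subr_ge0// gerBl.
have := ler_wpM2l x0 y1; rewrite mulr1.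
by move: ih; set y := _ ^+ k; set z := k%:R * x; set w := x * y; lra.
Qed.


(* [5 (9/10)^2 / 2 > 2] makes the union bound over the [n (n + 1)] pairs small,
   and [1 / 800 = (19/20 - 9/10)^2 / 2] is the smallest of the three rates. *)
Lemma failure_bound_simplify (R : realType) (L e K sg rho la mu : R) :
  0 <= L -> 0 < e -> e <= 1 -> e^-1 = expR L -> L * e <= 1 -> 5 <= K ->
  0 <= sg <= 1 -> 1 - sg <= K * e -> rho <= e ^+ 2 ->
  la = 19 / 20 * Num.sqrt L -> mu = 9 / 10 * Num.sqrt L ->
  e^-1 ^+ 2 * expR (mu ^+ 2 * (K + K ^+ 2 * e ^+ 2) / 2 - K * mu ^+ 2) +
    4 * (expR (la ^+ 2 * sg) / e^-1 + expR (la ^+ 2 * rho) - 1) +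
    2 * expR (mu ^+ 2 * sg / 2 - (la ^+ 2 * sg / 2 - (la - mu) * mu)) <=
  expR (K ^+ 2) * expR (- (L / 800)) +
  4 * (expR (- (L / 800)) + expR e - 1) + 2 * (expR K * expR (- (L / 800))).
Proof.
move=> L0 e0 e1 eL Le K5 sg01 sgK rhoe -> ->; set r := Num.sqrt L.
have r2 : r ^+ 2 = L by rewrite sqr_sqrtr.
have -> : (19 / 20 * r - 9 / 10 * r) * (9 / 10 * r) = 9 / 200 * L.
  by rewrite -r2; field.
rewrite !exprMn r2 eL.
have Lee : L * e ^+ 2 <= e.
  by rewrite expr2 mulrA ler_piMl// ltW.
have LKe : L * (1 - sg) <= K.
  apply: le_trans (ler_wpM2l L0 sgK) _.
  by rewrite mulrCA ler_piMr//; lra.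
have Lrho : L * rho <= e by apply: le_trans Lee; rewrite ler_wpM2l.
apply: lerD; first apply: lerD; last 1 first.
(* At [sg = 1] the exponent is [- (la - mu)^2 / 2 = - L / 800]; the true [sg] adds
   [37 / 800 L (1 - sg)], which is at most [K]. *)
- rewrite ler_wpM2l// -expRD ler_expR; move: LKe; rewrite mulrBr mulr1.
  by nra.
- rewrite expr2 -!expRD ler_expR.
  have KL : 5 * L <= K * L by rewrite ler_wpM2r.
  have KLe : K ^+ 2 * (L * e ^+ 2) <= K ^+ 2.
    by rewrite ler_piMr ?sqr_ge0//; lra.
  by have := sqr_ge0 K; nra.
- rewrite ler_wpM2l// lerD2r lerD//.
    rewrite -expRN -expRD ler_expR.
    have : L * sg <= L by rewrite ler_piMr//; case/andP: sg01.
    by nra.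
  by rewrite ler_expR; nra.
Qed.

Section FailureBound.
Variables (R : realType) (n k : nat) (phi : {linear 'rV[R]_n.+1 -> 'rV[R]_n}).
Hypothesis hphi : isometry_on_zhyperplane phi.
Hypothesis hk : (4 < k)%N.

Let L : R := ln n.+1%:R.
Let e : R := n.+1%:R^-1.

Let a i := phi (vertex R i).
Let A := \bigcup_(i : 'I_n.+1) rel_max_at k phi i.
Let coords := @dirderiv_coords R n k.

Let e0 : 0 < e. Proof. by rewrite invr_gt0. Qed.
Let e1 : e <= 1. Proof. by rewrite invf_le1// ler1n. Qed.

Lemma vertex_gram i j p q :
  \sum_l coords (a i) (a p) l * coords (a j) (a q) l =
  k%:R * (k.-1%:R * ((i == j)%:R - e) ^+ k.-2 *
            ((i == q)%:R - e) * ((p == j)%:R - e) +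
          ((i == j)%:R - e) ^+ k.-1 * ((p == q)%:R - e)).
Proof.
rewrite /coords; case: k hk => [|[|k']]// _.
by rewrite dirderiv_gram /= !isometry_dotv_vertex.
Qed.

Lemma gauss_mean_no_rel_max_le (m : R) :
  gauss_mean \1_(~` (@hpoly_of_coords R n k @^-1` A)) m ->
  m <= expR (k%:R ^+ 2) * expR (- (L / 800)) +
       4 * (expR (- (L / 800)) + expR e - 1) +
       2 * (expR k%:R * expR (- (L / 800))).
Proof.
have kE : k = k.-2.+2 by case: k hk => [|[|]].
have kE' : k.-1 = k.-2.+1 by rewrite {1}kE.
have kR : k%:R = k.-1%:R + 1 :> R by rewrite {1}kE -natr1 kE'.
have kX (x : R) : x ^+ k = x ^+ k.-2 * x * x by rewrite [in LHS]kE !exprSr.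
have kX' (x : R) : x ^+ k.-1 = x ^+ k.-2 * x by rewrite kE' exprSr.
have LM : e^-1 = expR L by rewrite invrK lnK// posrE.
have L0 : 0 <= L by rewrite ln_ge0// ler1n.
have Le : L * e <= 1.
  rewrite ler_pdivrMr// mul1r /L -natr1 addrC.
  apply: (@le_trans _ _ n%:R); last by rewrite lerDr.
  by rewrite le_ln1Dx// (lt_le_trans (ltrN10 R)).
have K5 : 5 <= k%:R :> R by rewrite ler_nat.
have s01 : 0 <= 1 - e <= 1 by rewrite subr_ge0 e1 gerBl ltW.
have sX01 j : 0 <= (1 - e) ^+ j <= 1.
  by case/andP: s01 => ? ?; rewrite exprn_ge0// exprn_ile1.
have sgK : 1 - (1 - e) ^+ k <= k%:R * e.
  by apply: one_sub_expr_le; rewrite e1 ltW.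
have rhoe : (- e) ^+ k <= e ^+ 2.
  apply: le_trans (ler_norm _) _; rewrite normrX normrN gtr0_norm//.
  by rewrite ler_wiXn2l// ?ltW//; apply: leq_trans hk.
move=> Am; apply: le_trans
  (failure_bound_simplify L0 e0 e1 LM Le K5 (sX01 k) sgK rhoe erefl erefl).
have -> : e^-1 = n.+1%:R by rewrite invrK.
(* Here [K = k], [sg = (1 - e)^k], [rho = (- e)^k] and [v = k + k^2 e^2], as read off from
   [vertex_gram]. *)
apply: (@gauss_mean_all_exceeded_le R n (hpoly_dim n k)
  (fun i => coords (a i) (a i)) (fun i j => coords (a i) (a j))) Am.
- by rewrite (lt_le_trans _ K5).
- by rewrite mulr_ge0 ?sqrtr_ge0// divr_ge0.
- by rewrite ler_wpM2r ?sqrtr_ge0//; lra.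
- by move=> i; rewrite vertex_gram eqxx mulr1n kX kX' kR; ring.
- by move=> i j /negbTE ij; rewrite vertex_gram ij mulr0n sub0r kX kX' kR; ring.
- move=> i j ij.
  rewrite vertex_gram !eqxx (eq_sym j) (negbTE ij) mulr1n mulr0n sub0r.
  have := sX01 k.-2; have := sX01 k.-1.+1; rewrite exprSr kX'.
  move=> /andP[_ s1] /andP[y0 y1].
  rewrite [leRHS](_ : _ = k%:R * (k%:R * e ^+ 2 + 1)); last by ring.
  apply: ler_wpM2l => //; apply: lerD => //.
  rewrite -mulrA mulrNN -expr2 ler_wpM2r ?sqr_ge0// kR.
  by rewrite (@le_trans _ _ k.-1%:R) ?lerDl// ler_piMr.
(* If no [j] had a derivative towards [a_j] at least as large as the one along [a_i], then [a_i]
   would be a relative maximum. *)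
move=> t nA i; apply: contrapT => noj; apply: nA; exists i => //.
rewrite rel_max_atE//= => j ji; rewrite !dirderiv_of_coords ltNge.
by apply/negP => gh; apply: noj; exists j => //; rewrite eq_sym.
Qed.

End FailureBound.

(** * The limit as [n] tends to infinity *)

Lemma cvg_expR_ln (R : realType) :
  expR (- (ln n.+1%:R / 800)) @[n --> \oo] --> (0 : R).
Proof.
apply: (@cvg_comp _ _ _ (fun n => ln n.+1%:R / 800 : R) (fun x => expR (- x))
  \oo +oo); last exact: cvgr_expR.
apply/cvgryPge => A; near=> n.
rewrite ler_pdivlMr ?ltr0n// -[leLHS]expRK ler_ln; last 2 first.
- by rewrite posrE expR_gt0.
- by rewrite posrE ltr0n.
apply: (@le_trans _ _ n%:R); last by rewrite ler_nat.
by near: n; exact: nbhs_infty_ger.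
Unshelve. all: end_near. Qed.

Lemma cvg_expR_harmonic (R : realType) :
  expR n.+1%:R^-1 @[n --> \oo] --> (1 : R).
Proof.
rewrite -[X in _ --> X]expR0.
apply: continuous_cvg; first exact: continuous_expR.
exact: cvg_harmonic.
Qed.

Theorem theorem3p2 (R : realType) (k : nat) (hk : (4 < k)%N)
    (phi : forall n : nat, {linear 'rV[R]_n.+1 -> 'rV[R]_n})
    (hphi : forall n : nat, isometry_on_zhyperplane (phi n)) :
  gaussW (\bigcup_(i : 'I_n.+1) rel_max_at k (phi n) i) @[n --> \oo] --> 1%E.
Proof.
pose x n : R := expR (- (ln n.+1%:R / 800)).
pose b n : R := expR (k%:R ^+ 2) * x n + 4 * (x n + expR n.+1%:R^-1 - 1) +
  2 * (expR k%:R * x n).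
have b0 : b n @[n --> \oo] --> 0.
  have x0 : x n @[n --> \oo] --> 0 := @cvg_expR_ln R.
  have e1 := @cvg_expR_harmonic R.
  rewrite [0](_ : _ = expR (k%:R ^+ 2) * 0 + 4 * (0 + 1 - 1) +
    2 * (expR k%:R * 0)); last by ring.
  apply: cvgD; last by apply: cvgMl_tmp; exact: cvgMl_tmp.
  apply: cvgD; first exact: cvgMl_tmp.
  by apply: cvgMl_tmp; apply: cvgB; [exact: cvgD|exact: cvg_cst].
apply: (@squeeze_cvge _ _ _ _ (fun n => (1 - b n)%:E) _ (fun=> 1%E)).
(* The mass of the complement is [m' = 1 - m]: its upper bound [b n] gives the lower estimate, and
   [m' >= 0] gives the upper one. *)
- near=> n; have mA := measurable_bigcup_rel_max_at (k := k) (hphi n).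
  have [m Am ->] := gaussW_gauss_mean mA.
  have [m' A'm _] := gaussW_gauss_mean (measurableC mA).
  rewrite preimage_setC in A'm.
  have mm' := gauss_meanC_indic Am A'm.
  have m'0 : 0 <= m'.
    have z := @gauss_mean_cst R (hpoly_dim n k) 0 (lexx 0).
    by case: (A'm) => _ p _; exact: le_gauss_mean p z A'm.
  have := gauss_mean_no_rel_max_le (hphi n) hk A'm.
  by rewrite !lee_fin -/(x n) -/(b n); lra.
- apply: cvg_EFin; first by near=> n.
  rewrite -[X in _ --> X]subr0; apply: cvgB b0; exact: cvg_cst.
- exact: cvg_cst.
Unshelve. all: end_near. Qed.
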